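(* Let $P=[p_{ij}]$ be the $m\times m$ transition matrix of a finite irreducible discrete time Markov chain with stationary probability vector $\pi^T$ and column sum vector $c^T=(c_1,\dots,c_m)$, $c_j=\sum_{i=1}^m p_{ij}$. Let $H=[h_{ij}]=[I-P+ec^T]^{-1}$ and $Z=[z_{ij}]=[I-P+e\pi^T]^{-1}$, where $e$ is the column vector of ones, and let $K$ be Kemeny's constant of the chain. Then $$K=1-\frac1m+\mathrm{tr}(H)=1-\frac1m+\sum_{j=1}^m h_{jj},$$ $$K=\mathrm{tr}(Z)=\sum_{j=1}^m z_{jj}.$$
   Context: The chain $\{X_n\}_{n\ge0}$ has state space $\{1,\dots,m\}$. $P$ is row-stochastic: $p_{ij}\ge 0$ and $\sum_{j=1}^m p_{ij}=1$ for all $i$. The stationary probability vector is the unique $\pi$ with $\pi^TP=\pi^T$ and $\pi^Te=1$. The mean first passage time is $m_{ij}=E[\min\{n\ge1: X_n=j\}\mid X_0=i]$, which is finite for all $i,j$ (so $m_{jj}$ is the mean return time to $j$). Kemeny's constant is $K=\sum_{j=1}^m\pi_jm_{ij}$ (the sum includes the term $j=i$), whose value is independent of $i$. The matrices $I-P+ec^T$ and $I-P+e\pi^T$ are nonsingular, so $H$ and $Z$ are well defined. *)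

(* Defs.v *)
From HB Require Import structures.
From mathcomp Require Import all_boot all_order all_algebra.
From mathcomp Require Import all_classical all_reals all_analysis.

Set Implicit Arguments.
Unset Strict Implicit.
Unset Printing Implicit Defensive.

Import Order.TTheory GRing.Theory Num.Theory.
Import numFieldNormedType.Exports.

Local Open Scope classical_set_scope.
Local Open Scope ring_scope.

Definition row_stochastic (R : realType) (m : nat) (P : 'M[R]_m) : Prop :=
  (forall i j, 0 <= P i j) /\ (forall i, \sum_j P i j = 1).

Definition irreducible_chain (R : realType) (m : nat) (P : 'M[R]_m) : Prop :=
  forall i j, exists n : nat, 0 < (P ^+ n) i j.

(* For irreducible stochastic P these equations have exactly one solution, whose
   entries are positive, so nonnegativity is not required separately. *)
Definition stationary (R : realType) (m : nat) (P : 'M[R]_m) (pi : 'rV[R]_m)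
    : Prop :=
  pi *m P = pi /\ pi *m (const_mx 1 : 'cV[R]_m) = 1%:M.

Definition column_sums (R : realType) (m : nat) (P : 'M[R]_m) : 'rV[R]_m :=
  \row_j \sum_i P i j.

Definition H_matrix (R : realType) (m : nat) (P : 'M[R]_m) : 'M[R]_m :=
  invmx (1%:M - P + (const_mx 1 : 'cV[R]_m) *m column_sums P).

Definition Z_matrix (R : realType) (m : nat) (P : 'M[R]_m) (pi : 'rV[R]_m)
    : 'M[R]_m :=
  invmx (1%:M - P + (const_mx 1 : 'cV[R]_m) *m pi).

(* The second clause is
     Pr(X_(n+1) = j | X_n = x_n, ..., X_0 = x_0) = P (x_n) j
   multiplied by Pr(X_n = x_n, ..., X_0 = x_0), so that it is also meaningful
   (and trivially true) for histories of probability zero.  The law of X_0 is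
   arbitrary. *)
Definition markov_chain (R : realType) (m : nat) (P : 'M[R]_m)
    (d : measure_display) (T : measurableType d) (Pr : probability T R)
    (X : nat -> T -> 'I_m) : Prop :=
  (forall n j, measurable [set w | X n w = j]) /\
  (forall (n : nat) (x : nat -> 'I_m) (j : 'I_m),
     Pr [set w | (forall k, (k <= n)%N -> X k w = x k) /\ X n.+1 w = j] =
     (Pr [set w | forall k, (k <= n)%N -> X k w = x k] * (P (x n) j)%:E)%E).

(* min {n >= 1 : X_n = j}, equal to +oo on paths that never visit j after
   time 0. *)
Definition first_passage_time (R : realType) (m : nat) (T : Type)
    (X : nat -> T -> 'I_m) (j : 'I_m) (w : T) : \bar R :=
  ereal_inf [set (n%:R)%:E | n in [set n : nat | (1 <= n)%N /\ X n w = j]].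

(* E[first passage time to j | X_0 = i], meaningful when Pr(X_0 = i) > 0. *)
Definition mean_first_passage (R : realType) (m : nat)
    (d : measure_display) (T : measurableType d) (Pr : probability T R)
    (X : nat -> T -> 'I_m) (i j : 'I_m) : \bar R :=
  ((\int[Pr]_(w in [set w | X 0%N w = i]) first_passage_time R X j w)
   / Pr [set w | X 0%N w = i])%E.

(* Kemeny's constant; the value does not depend on i when P is irreducible. *)
Definition kemeny (R : realType) (m : nat) (pi : 'rV[R]_m)
    (d : measure_display) (T : measurableType d) (Pr : probability T R)
    (X : nat -> T -> 'I_m) (i : 'I_m) : \bar R :=
  (\sum_(j < m) (pi ord0 j)%:E * mean_first_passage Pr X i j)%E.

(* Main.v *)
(* For fixed [j], let [Q] be [P] with column [j] set to zero.  Starting from [i],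
   the chain avoids [j] at times 1, ..., n with probability [(Q^n e)_i], so that
   [m_ij] is the sum of these over [n >= 0].  By the maximum principle [I - Q] is
   invertible, hence the sum is finite, and it satisfies the first-step equations
   [m_ij = 1 + sum_(l <> j) p_il m_lj].
   For a row vector [t] with [tau = t e <> 0], put [G = (I - P + e t)^-1].  The
   first-step equations give [K = 1 - 1/tau + tr G]; [t = c^T] and [t = pi^T]
   yield the two formulas. *)

Require Import Defs.
From HB Require Import structures.
From mathcomp Require Import all_boot all_order all_algebra.
From mathcomp Require Import all_classical all_reals all_analysis.

Set Implicit Arguments.
Unset Strict Implicit.
Unset Printing Implicit Defensive.

Import Order.TTheory GRing.Theory Num.Theory.
Import numFieldNormedType.Exports.

Local Open Scope classical_set_scope.
Local Open Scope ring_scope.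

(** * Maximum principle and invertibility *)

Lemma unitmx_col_inj (F : fieldType) (m : nat) (A : 'M[F]_m) :
  (forall v : 'cV_m, A *m v = 0 -> v = 0) -> A \in unitmx.
Proof.
move=> Ainj; rewrite -unitmx_tr -row_free_unit; apply: inj_row_free => v vA0.
apply: trmx_inj; rewrite trmx0; apply: Ainj.
by rewrite -[A]trmxK -trmx_mul vA0 trmx0.
Qed.

Lemma stochastic_exp (R : realType) (m : nat) (P : 'M[R]_m) (n : nat) :
  row_stochastic P -> row_stochastic (P ^+ n).
Proof.
case=> P0 P1; elim: n => [|n [IH0 IH1]]; split.
- by move=> k l; rewrite mxE ler0n.
- move=> k; rewrite (bigD1 k) //= mxE eqxx big1 ?addr0 // => l /negPf lk.
  by rewrite mxE eq_sym lk.
- by move=> k l; rewrite exprS mxE sumr_ge0 // => q _; rewrite mulr_ge0.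
- move=> k; rewrite exprS; under eq_bigr do rewrite mxE.
  rewrite exchange_big /= -[RHS](P1 k); apply: eq_bigr => q _.
  by rewrite -mulr_sumr IH1 mulr1.
Qed.

(* Maximum principle: [w <= P w] propagates to [w <= P^n w], and at a maximum
   of [w] an average charging the zero [w j] would be strictly smaller. *)
Lemma subharmonic_eq0 (R : realType) (m : nat) (P : 'M[R]_m) (j : 'I_m)
    (w : 'I_m -> R) :
  row_stochastic P -> irreducible_chain P ->
  (forall k, 0 <= w k) -> w j = 0 ->
  (forall k, w k <= \sum_l P k l * w l) -> forall k, w k = 0.
Proof.
move=> hP hirr w0 wj0 wP.
have wPn n k : w k <= \sum_l (P ^+ n) k l * w l.
  elim: n k => [|n IH] k.
    rewrite (bigD1 k) //= mxE eqxx mul1r lerDl sumr_ge0 // => l _.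
    by rewrite mulr_ge0 // mxE ler0n.
  apply: le_trans (wP k) _; rewrite exprS.
  under [leRHS]eq_bigr do rewrite mxE mulr_suml.
  rewrite exchange_big /= ler_sum // => q _.
  under eq_bigr do rewrite -mulrA.
  by rewrite -mulr_sumr ler_wpM2l // hP.1.
pose k0 := [arg max_(k > j) w k]%O.
have wk0 k : w k <= w k0 by rewrite /k0; case: arg_maxP => // q _; apply.
suff k00 : w k0 = 0 by move=> k; apply/eqP; rewrite eq_le w0 -k00 wk0.
have [n Pn] := hirr k0 j.
have [Pn0 Pn1] := stochastic_exp n hP.
(* As [(P ^+ n) k0 j] is positive, it suffices that its product with [w k0] is at most 0. Adding
   [w k0], spread over row [k0] of [P ^+ n], reduces this to [wPn]. *)
apply/eqP; rewrite eq_le w0 andbT.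
rewrite -(pmulr_rle0 _ Pn) -(lerD2r (w k0)) add0r.
rewrite -[leRHS]mul1r -(Pn1 k0) mulr_suml [leRHS](bigD1 j) //= lerD2l.
apply: le_trans (wPn n k0) _; rewrite (bigD1 j) //= wj0 mulr0 add0r.
by apply: ler_sum => l _; rewrite ler_wpM2l.
Qed.

(** By the triangle inequality, [|v|] reset to 0 at [j] satisfies the maximum principle; the value
    of [v] at [j] is then a sum of zeros too. *)
Lemma subharmonic_off_eq0 (R : realType) (m : nat) (P : 'M[R]_m) (j : 'I_m)
    (v : 'I_m -> R) :
  row_stochastic P -> irreducible_chain P ->
  (forall k, v k = \sum_(l | l != j) P k l * v l) -> forall k, v k = 0.
Proof.
move=> hP hirr vQ.
have w0 : forall k, `|v k| *+ (k != j) = 0.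
  apply: (@subharmonic_eq0 _ _ P j) => //.
    by rewrite eqxx.
  move=> k.
  apply: (@le_trans _ _ `|v k|); first by rewrite mulrb; case: ifP.
  rewrite {1}vQ; apply: le_trans (ler_norm_sum _ _ _) _; rewrite [leRHS](bigD1 j) //=.
  rewrite eqxx mulr0 add0r ler_sum // => l lj.
  by rewrite lj mulr1n normrM ger0_norm ?hP.1.
move=> k; rewrite vQ big1 // => l lj.
by have := w0 l; rewrite lj mulr1n => /eqP; rewrite normr_eq0 => /eqP ->; rewrite mulr0.
Qed.

(** Subtracting the value at [j] preserves harmonicity, because rows sum to 1, and removes the term
    at [j]. *)
Lemma harmonic_const (R : realType) (m : nat) (P : 'M[R]_m) (v : 'cV[R]_m) :
  row_stochastic P -> irreducible_chain P -> P *m v = v ->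
  forall k l, v k ord0 = v l ord0.
Proof.
move=> hP hirr Pv k j; apply/eqP; rewrite -subr_eq0; apply/eqP.
apply: (subharmonic_off_eq0 (j := j) (v := fun k => v k ord0 - v j ord0) hP hirr).
move=> {}k; rewrite -{1}Pv mxE -[v j ord0 in LHS]mul1r -(hP.2 k) mulr_suml -sumrB.
rewrite (bigD1 j) //= subrr add0r.
by apply: eq_bigr => l _; rewrite mulrBr.
Qed.

(** For a kernel vector [v], multiplying by [pi] leaves [t *m v = 0]. So [v] is harmonic, hence
    constant, and the nonzero sum of [t] forces it to vanish. *)
Lemma perturbed_unitmx (R : realType) (m : nat) (P : 'M[R]_m) (pi t : 'rV[R]_m) :
  row_stochastic P -> irreducible_chain P -> stationary P pi ->
  \sum_j t ord0 j != 0 -> 1%:M - P + (const_mx 1 : 'cV_m) *m t \in unitmx.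
Proof.
move=> hP hirr [piP pi1] t0; apply: unitmx_col_inj => v Av0.
have tv0 : t *m v = 0.
  have := congr1 (mulmx pi) Av0; rewrite mulmxA mulmxDr mulmxBr mulmx1 piP subrr.
  by rewrite add0r mulmxA pi1 mul1mx mulmx0.
have Pv : P *m v = v.
  move: Av0; rewrite mulmxDl -mulmxA tv0 mulmx0 addr0 mulmxBl mul1mx.
  by move/eqP; rewrite subr_eq0 => /eqP.
have vc := harmonic_const hP hirr Pv.
apply/matrixP => k z; rewrite ord1 mxE.
move/matrixP: tv0 => /(_ ord0 ord0); rewrite !mxE.
under eq_bigr do rewrite (vc _ k).
by rewrite -mulr_suml => /eqP; rewrite mulf_eq0 (negPf t0) => /eqP.
Qed.

(** * Trace formula from the first-step equations *)

(* With [N = M - D], [D] the diagonal of [M], the first-step equations read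
   [(I - P) N = e e^T - D]; they give [N = e s - G D] for some row [s], and
   comparing diagonals determines [s]. *)
Lemma kemeny_tr (R : realType) (m : nat) (P M : 'M[R]_m) (pi t : 'rV[R]_m)
    (i : 'I_m) :
  row_stochastic P -> irreducible_chain P -> stationary P pi ->
  (forall k j, M k j = 1 + \sum_(l | l != j) P k l * M l j) ->
  \sum_j t ord0 j != 0 ->
  \sum_j pi ord0 j * M i j =
  1 - (\sum_j t ord0 j)^-1
    + \tr (invmx (1%:M - P + (const_mx 1 : 'cV_m) *m t)).
Proof.
move=> hP hirr hpi MP t0.
set A := 1%:M - P + _; set G := invmx A; set tau := \sum_j _ in t0 *.
have uA : A \in unitmx := perturbed_unitmx hP hirr hpi t0.
have [piP pi1] := hpi.
pose e : 'cV[R]_m := const_mx 1.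
have Pe : P *m e = e.
  apply/matrixP => k z; rewrite !mxE -[RHS](hP.2 k).
  by apply: eq_bigr => l _; rewrite mxE mulr1.
have te : t *m e = tau%:M.
  apply/matrixP => k z; rewrite !ord1 !mxE eqxx mulr1n.
  by apply: eq_bigr => l _; rewrite mxE mulr1.
pose D : 'M[R]_m := diag_mx (\row_j M j j).
pose N := M - D.
have NE k j : N k j = M k j *+ (k != j).
  rewrite !mxE; case: eqP => [->|_]; first by rewrite mulr1n subrr.
  by rewrite mulr0n subr0.
have MN : M = e *m e^T + P *m N.
  apply/matrixP => k j; rewrite MP mxE !mxE big_ord1 !mxE mulr1; congr (_ + _).
  rewrite [RHS](bigD1 j) //= NE eqxx mulr0 add0r.
  by apply: eq_bigr => l lj; rewrite NE lj.
have IPN : (1%:M - P) *m N = e *m e^T - D.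
  by apply/eqP; rewrite mulmxBl mul1mx subr_eq addrAC -MN.
(* Multiplying [IPN] by [pi] annihilates its left side: the mean return time is the inverse of the
   stationary probability. *)
have Dpi k : pi ord0 k * M k k = 1.
  have := congr1 (mulmx pi) IPN; rewrite mulmxA (mulmxBr _ 1%:M) mulmx1 piP subrr mul0mx.
  rewrite mulmxBr mulmxA pi1 mul1mx => /esym/eqP; rewrite subr_eq0 => /eqP/matrixP.
  by move=> /(_ ord0 k); rewrite mul_mx_diag !mxE => <-.
have Ge : G *m e = tau^-1 *: e.
  rewrite -[RHS]mul1mx -(mulVmx uA) -mulmxA; congr (_ *m _).
  rewrite -scalemxAr mulmxDl mulmxBl mul1mx Pe subrr add0r -mulmxA te.
  by rewrite mul_mx_scalar scalerA mulVf ?scale1r.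
have NG : N = G *m e *m (e^T + t *m N) - G *m D.
  rewrite -{1}[N]mul1mx -(mulVmx uA) -!mulmxA -mulmxBr; congr (_ *m _).
  by rewrite /A mulmxDl IPN (mulmxDr e) (mulmxA e) addrAC.
have [s Ns] : exists s : 'I_m -> R, forall k j, N k j = s j - G k j * M j j.
  exists (fun j => tau^-1 * (e^T + t *m N) ord0 j) => k j.
  rewrite {1}NG Ge -scalemxAl [LHS]mxE mul_mx_diag [in X in _ + X]mxE [in X in _ + X]mxE.
  rewrite [X in _ - _ * X]mxE; congr (_ - _).
  by rewrite mxE [X in _ * X]mxE big_ord1 [e k _]mxE mul1r.
have sE j : s j = G j j * M j j.
  by apply/eqP; rewrite -subr_eq0 -Ns NE eqxx.
(* By [Dpi], the terms [s j] average to the trace of [G], and the remaining terms to the sum of row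
   [k] of [G], which is [tau^-1]. *)
have Npi k : \sum_j pi ord0 j * N k j = \tr G - tau^-1.
  rewrite /mxtrace; under eq_bigr do rewrite Ns sE mulrBr !(mulrCA (pi _ _)) Dpi !mulr1.
  rewrite sumrB; congr (_ - _).
  move/matrixP: Ge => /(_ k ord0); rewrite !mxE mulr1 => <-.
  by apply: eq_bigr => l _; rewrite mxE mulr1.
rewrite (_ : \sum_j _ = \sum_j pi ord0 j * N i j + 1).
  by rewrite Npi addrC addrA addrAC.
rewrite (bigD1 i) //= Dpi addrC [in RHS](bigD1 i) //= NE eqxx mulr0 add0r.
by congr (_ + _); apply: eq_bigr => l li; rewrite NE eq_sym li.
Qed.

(** * Taboo probabilities and their series *)

(* The probability [(Q^n e)_k] of avoiding [j] at times 1, ..., n from [k]. *)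
Fixpoint taboo_prob (R : realType) (m : nat) (P : 'M[R]_m) (j : 'I_m) (n : nat)
    (k : 'I_m) : R :=
  if n is n'.+1 then \sum_(l | l != j) P k l * taboo_prob P j n' l else 1.

Lemma taboo_prob_ge0 (R : realType) (m : nat) (P : 'M[R]_m) (j : 'I_m) (n : nat)
    (k : 'I_m) : row_stochastic P -> 0 <= taboo_prob P j n k.
Proof.
case=> P0 _; elim: n k => [|n IH] k /=; first exact: ler01.
by apply: sumr_ge0 => l _; rewrite mulr_ge0.
Qed.

(** Applying [1%:M - Q] to a partial sum telescopes to [u 0 - u N], with entries in [0, 1]; the
    absolute entries of the inverse then bound every partial sum. *)
Lemma taboo_series_bounded (R : realType) (m : nat) (P : 'M[R]_m) (j : 'I_m) :
  row_stochastic P -> irreducible_chain P ->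
  exists B : R, forall N k, \sum_(0 <= n < N) taboo_prob P j n k <= B.
Proof.
move=> hP hirr; have [P0 P1] := hP.
pose Q : 'M[R]_m := \matrix_(k, l) (P k l *+ (l != j)).
have QE (v : 'cV[R]_m) k : (Q *m v) k ord0 = \sum_(l | l != j) P k l * v l ord0.
  rewrite mxE (bigD1 j) //= mxE eqxx mul0r add0r.
  by apply: eq_bigr => l lj; rewrite mxE lj.
have uQ : 1%:M - Q \in unitmx.
  apply: unitmx_col_inj => v /eqP; rewrite mulmxBl mul1mx subr_eq0 => /eqP vQ.
  apply/matrixP => k z; rewrite ord1 [RHS]mxE.
  apply: (@subharmonic_off_eq0 _ _ P j (fun k => v k ord0)) => // l.
  by rewrite {1}vQ QE.
pose G := invmx (1%:M - Q).
pose u n : 'cV[R]_m := \col_k taboo_prob P j n k.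
have uS n : Q *m u n = u n.+1.
  apply/matrixP => k z; rewrite ord1 QE mxE /=.
  by apply: eq_bigr => l _; rewrite mxE.
have telescope N : (1%:M - Q) *m \sum_(0 <= n < N) u n = u 0%N - u N.
  rewrite mulmx_sumr (eq_bigr (fun n => - (u n.+1 - u n))).
    by rewrite sumrN telescope_sumr // opprB.
  by move=> n _; rewrite mulmxBl mul1mx uS opprB.
have u01 n k : 0 <= u n k ord0 <= 1.
  rewrite mxE taboo_prob_ge0 //=; elim: n k => //= n IH k.
  rewrite -(P1 k) [leRHS](bigD1 j) //= -[leLHS]add0r lerD //.
  by rewrite ler_sum // => l _; rewrite ler_piMr.
have ubound n k : `|(u 0%N - u n) k ord0| <= 1.
  have := u01 n k; rewrite !mxE /= => /andP[un0 un1].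
  by rewrite ger0_norm ?subr_ge0// gerBl.
exists (\sum_k \sum_l `|G k l|) => N k.
have -> : \sum_(0 <= n < N) taboo_prob P j n k = (G *m (u 0%N - u N)) k ord0.
  rewrite -telescope mulKmx // summxE; apply: eq_bigr => n _.
  by rewrite mxE.
rewrite mxE [leRHS](bigD1 k) //= -[leLHS]addr0 lerD ?sumr_ge0 //; last first.
  by move=> l _; rewrite sumr_ge0.
apply: le_trans (ler_norm _) _; apply: le_trans (ler_norm_sum _ _ _) _.
by apply: ler_sum => l _; rewrite normrM ler_piMr.
Qed.

Lemma taboo_first_step (R : realType) (m : nat) (P : 'M[R]_m) :
  row_stochastic P -> irreducible_chain P ->
  exists M : 'M[R]_m,
    (forall k j, (\sum_(0 <= n <oo) (taboo_prob P j n k)%:E)%E = (M k j)%:E) /\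
    (forall k j, M k j = 1 + \sum_(l | l != j) P k l * M l j).
Proof.
move=> hP hirr.
have u0 j n k : (0 <= (taboo_prob P j n k)%:E)%E.
  by rewrite lee_fin taboo_prob_ge0.
pose V k j := (\sum_(0 <= n <oo) (taboo_prob P j n k)%:E)%E.
pose M : 'M[R]_m := \matrix_(k, j) fine (V k j).
have VM k j : V k j = (M k j)%:E.
  (* [fine] sends infinite values to 0, so finiteness of the series must come from the uniform
     bound. *)
  rewrite mxE fineK //; have [B uB] := taboo_series_bounded j hP hirr.
  rewrite ge0_fin_numE ?nneseries_ge0 // (@le_lt_trans _ _ B%:E) ?ltry //.
  apply: lime_le; first exact: is_cvg_nneseries.
  by apply: nearW => N; rewrite sumEFin lee_fin.
exists M; split=> // k j; apply: EFin_inj; rewrite -VM EFinD.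
(* The term at 0 is the summand 1; in the shifted series, nonnegativity lets the finite sum over [l]
   be exchanged with the limit. *)
rewrite /V nneseries_recl //; congr (_ + _)%E.
rewrite -sumEFin -(nneseries_addn 1) //.
under [RHS]eq_bigr => l _.
  rewrite EFinM -VM -nneseriesZl //; over.
rewrite -nneseries_sum; last by move=> l n _; rewrite mule_ge0 // lee_fin hP.1.
apply: eq_eseriesr => n _; rewrite addn1 /= -sumEFin.
by apply: eq_bigr => l _; rewrite EFinM.
Qed.

(** * Avoidance events and first passage times *)

(** Time [n] itself is excluded, so a path may start at [j] and the passage is then a return. *)
Definition avoids (m : nat) (T : Type) (X : nat -> T -> 'I_m) (j : 'I_m)
    (n r : nat) : set T :=
  [set w | forall k, (n < k <= n + r)%N -> X k w <> j].

Lemma measurable_avoids (m : nat) (d : measure_display) (T : measurableType d)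
    (X : nat -> T -> 'I_m) (j : 'I_m) (n r : nat) :
  (forall n j, measurable [set w | X n w = j]) -> measurable (avoids X j n r).
Proof.
move=> mX; apply: (@bigcap_measurableType _ _ (fun k => [set w | X k w <> j])
  [set k | (n < k <= n + r)%N]) => k _.
exact: (measurableC (mX k j)).
Qed.

(* Induction on [r] for all histories at once: conditioning on [X_(n+1)] extends
   the history by one step. *)
Lemma avoids_law (R : realType) (m : nat) (P : 'M[R]_m) (d : measure_display)
    (T : measurableType d) (Pr : probability T R) (X : nat -> T -> 'I_m)
    (j : 'I_m) (r n : nat) (x : nat -> 'I_m) :
  markov_chain P Pr X -> row_stochastic P ->
  (Pr ([set w | forall k, (k <= n)%N -> X k w = x k] `&` avoids X j n r) =
   Pr [set w | forall k, (k <= n)%N -> X k w = x k]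
     * (taboo_prob P j r (x n))%:E)%E.
Proof.
move=> [mX markov] hP; elim: r n x => [|r IH] n x.
  rewrite mule1; congr (Pr _); apply/seteqP; split=> w /=; first by case.
  by split=> // k; rewrite addn0 ltnNge => /andP[/negP].
(* [y l] is the history [x] prolonged by the state [l] at time [n.+1]. *)
pose y l k := if (k <= n)%N then x k else l.
pose C n x := [set w | forall k, (k <= n)%N -> X k w = x k].
have CS l : C n.+1 (y l) = [set w | C n x w /\ X n.+1 w = l].
  apply/seteqP; split=> w /=.
    move=> Cw; split=> [k kn|]; first by rewrite Cw /y ?kn // ltnW.
    by rewrite Cw // /y ltnn.
  move=> [Cw Xl] k; rewrite leq_eqVlt => /orP[/eqP ->|kn]; rewrite /y.
    by rewrite ltnn.
  by rewrite -ltnS kn Cw.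
have mC n' x' : measurable (C n' x').
  exact: (@bigcap_measurableType _ _ (fun k => [set w | X k w = x' k])
    [set k | (k <= n')%N]).
pose F l := C n.+1 (y l) `&` avoids X j n.+1 r.
(* Disjoint decomposition according to the state at time [n.+1], which must differ from [j]. *)
have -> : C n x `&` avoids X j n r.+1 = \bigcup_(l in [set` predC1 j]) F l.
  apply/seteqP; split=> w /=.
    move=> [Cw Aw]; exists (X n.+1 w).
      by apply/eqP; apply: Aw; rewrite ltnSn /= addnS ltnS leq_addr.
    split; first by rewrite CS.
    by move=> k /andP[nk kr]; apply: Aw; rewrite ltnW //= -addSnnS.
  move=> [l /eqP lj []]; rewrite CS => -[Cw Xl] Aw; split=> // k /andP[].
  rewrite leq_eqVlt => /orP[/eqP <- _|nk kr]; first by rewrite Xl.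
  by apply: Aw; rewrite nk /= addSnnS.
rewrite measure_fin_bigcup; last 3 first.
- exact: finite_finset.
- by move=> l l' _ _ [w [[+ _] [+ _]]]; rewrite !CS => -[_ <-] [_ <-].
- by move=> l _; apply: measurableI => //; exact: measurable_avoids.
rewrite -(@bigfs _ _ _ _ (index_enum _) (predC1 j)) ?index_enum_uniq //; last first.
  by move=> l _; rewrite mem_index_enum.
rewrite (eq_bigr (fun l => Pr (C n x) * (P (x n) l * taboo_prob P j r l)%:E)%E).
  rewrite -ge0_sume_distrr ?sumEFin // => l _.
  by rewrite lee_fin mulr_ge0 ?taboo_prob_ge0 //; exact: hP.1.
move=> l _; rewrite [LHS](IH n.+1 (y l)) -/(C _ _) CS markov EFinM muleA.
by rewrite [X in taboo_prob _ _ _ X]/y ltnn.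
Qed.

(** Tail-sum formula: the path lies in [avoids X j 0 n] exactly when its first passage time exceeds
    [n], so the series counts that time, and diverges if [j] is never visited. *)
Lemma first_passage_time_series (R : realType) (m : nat) (T : Type)
    (X : nat -> T -> 'I_m) (j : 'I_m) (w : T) :
  first_passage_time R X j w = (\sum_(0 <= n <oo) (\1_(avoids X j 0 n) w)%:E)%E.
Proof.
have ind0 n : (0 <= (\1_(avoids X j 0 n) w : R)%:E)%E by rewrite lee_fin.
rewrite /first_passage_time.
have [ex|nex] := pselect (exists n, (0 < n)%N && (X n w == j)).
  case: (ex_minnP ex) => n /andP[n0 /eqP Xn] nmin.
  have inA k : (k < n)%N -> w \in avoids X j 0 k.
    move=> kn; rewrite inE => l /andP[l0 lk] Xl.
    have := nmin l; rewrite l0 Xl eqxx => /(_ isT).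
    by rewrite leqNgt (leq_ltn_trans lk).
  have notinA k : (n <= k)%N -> (w \in avoids X j 0 k) = false.
    move=> nk; apply/negbTE; rewrite notin_setE => /(_ n).
    by rewrite n0 add0n nk => /(_ isT).
  rewrite (nneseries_split 0 n) // add0n eseries0 ?adde0; last first.
    by move=> k nk _; rewrite indicE notinA.
  rewrite (@eq_big_nat _ _ _ _ _ _ (fun=> 1%:E)); last first.
    by move=> k /andP[_ kn]; rewrite indicE inA.
  rewrite sumEFin big_const_nat subn0 iter_addr_0.
  apply/eqP; rewrite eq_le; apply/andP; split.
    by apply: ereal_inf_lbound; exists n.
  apply: le_ereal_inf_tmp => _ [k [k0 Xk] <-].
  by rewrite lee_fin ler_nat nmin // k0 Xk eqxx.
rewrite (_ : [set _ | _ in _] = set0) ?ereal_inf0; last first.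
  rewrite -subset0 => z [n [n0 Xn] _]; apply: nex; exists n.
  by rewrite n0 Xn eqxx.
rewrite (@eq_eseriesr _ _ (fun=> 1%:E)); last first.
  move=> n _; rewrite indicE mem_set // => k /andP[k0 _] Xk; apply: nex.
  by exists k; rewrite k0 Xk eqxx.
apply/esym/eq_infty => B; set S := limn _.
apply: (@le_trans _ _ (\sum_(0 <= k < Num.bound `|B|) 1%:E)%E);
  last exact: nneseries_lim_ge.
rewrite sumEFin big_const_nat subn0 iter_addr_0 lee_fin.
exact: le_trans (ler_norm B) (ltW (archi_boundP (normr_ge0 B))).
Qed.


(** The tail-sum series is integrated term by term, and the common factor [Pr A] cancels. *)
Lemma mean_first_passageE (R : realType) (m : nat) (P : 'M[R]_m)
    (d : measure_display) (T : measurableType d) (Pr : probability T R)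
    (X : nat -> T -> 'I_m) (i j : 'I_m) :
  markov_chain P Pr X -> row_stochastic P ->
  (0 < Pr [set w | X 0%N w = i])%E ->
  (mean_first_passage Pr X i j =
   \sum_(0 <= n <oo) (taboo_prob P j n i)%:E)%E.
Proof.
move=> hX hP; rewrite /mean_first_passage; have [mX _] := hX.
set A := [set w | _] => A0.
have mA : measurable A := mX _ _.
have Afin : Pr A \is a fin_num := fin_num_measure Pr A mA.
under eq_integral do rewrite first_passage_time_series.
have mB n : measurable (avoids X j 0 n) := measurable_avoids j 0 n mX.
rewrite integral_nneseries //; last first.
  by move=> n; apply/measurable_realfun.measurable_EFinP;
     exact: measurable_realfun.measurable_indic.
(* The initial event is a history of length one, so [avoids_law] applies at time 0. *)
have AE : A = [set w | forall k, (k <= 0)%N -> X k w = i].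
  apply/seteqP; split=> w /=; last exact.
  by move=> Aw k; rewrite leqn0 => /eqP ->.
rewrite (@eq_eseriesr _ _ (fun n => (fine (Pr A))%:E * (taboo_prob P j n i)%:E)%E).
  rewrite nneseriesZl; last by move=> n _; rewrite lee_fin taboo_prob_ge0.
  by rewrite muleAC fineK // divee ?mul1e // gt_eqF.
move=> n _; rewrite integral_indic // setIC fineK // [in LHS]AE.
by rewrite [LHS](@avoids_law _ _ P _ _ _ _ _ _ _ (fun=> i)) // -AE.
Qed.

Theorem theorem13 (R : realType) (m : nat) (P : 'M[R]_m) (pi : 'rV[R]_m)
    (d : measure_display) (T : measurableType d) (Pr : probability T R)
    (X : nat -> T -> 'I_m)
    (hP : row_stochastic P) (hirr : irreducible_chain P)
    (hpi : stationary P pi) (hX : markov_chain P Pr X)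
    (i : 'I_m) (hi : (0 < Pr [set w | X 0%N w = i])%E) :
  [/\ kemeny pi Pr X i = (1 - m%:R^-1 + \tr (H_matrix P))%:E,
      \tr (H_matrix P) = \sum_(j < m) H_matrix P j j,
      kemeny pi Pr X i = (\tr (Z_matrix P pi))%:E
    & \tr (Z_matrix P pi) = \sum_(j < m) Z_matrix P pi j j].
Proof.
have [M [VM MP]] := taboo_first_step hP hirr.
have -> : kemeny pi Pr X i = (\sum_j pi ord0 j * M i j)%:E.
  rewrite /kemeny -sumEFin; apply: eq_bigr => j _.
  by rewrite (mean_first_passageE j hX hP hi) VM EFinM.
(* The two values of [tau]: [m] for the column sums, and 1 for [pi], where [1 - tau^-1] vanishes. *)
have sum_c : \sum_j column_sums P ord0 j = m%:R.
  under eq_bigr do rewrite mxE; rewrite exchange_big /=.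
  by rewrite (eq_bigr (fun=> 1)) ?sumr_const ?card_ord // => k _; exact: hP.2.
have sum_pi : \sum_j pi ord0 j = 1.
  have /matrixP/(_ ord0 ord0) := hpi.2; rewrite !mxE eqxx mulr1n => <-.
  by apply: eq_bigr => j _; rewrite mxE mulr1.
have m0 : m%:R != 0 :> R by rewrite pnatr_eq0 -lt0n (leq_ltn_trans _ (ltn_ord i)).
split=> //; congr EFin.
  by rewrite (kemeny_tr i hP hirr hpi MP (t := column_sums P)) sum_c.
by rewrite (kemeny_tr i hP hirr hpi MP (t := pi)) sum_pi ?oner_eq0 // invr1 subrr add0r.
Qed.
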